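(* Let $k\ge 2$, $n=2^{k-1}-1$, and let $f(x_1,\dots,x_n)$ be a complete Boolean function with $k$ zeros. Then every minimal DNF of $f$ (i.e. every DNF realizing $f$ with the smallest possible rank) has rank at least $3n\left(1-e^{-\log_2 n/36}\right)$.
   Context: For a Boolean function $f:\{0,1\}^n\to\{0,1\}$ with exactly $k$ zeros, its zero matrix $M_f$ is the $k\times n$ $0/1$ matrix whose rows are the distinct zeros of $f$; column $i$ corresponds to the variable $x_i$. $f$ is called reduced if $M_f$ has no all-zero column, no all-one column, no two equal columns, and no column equal to the coordinatewise complement of another column. A reduced function with exactly $k$ zeros and $n=2^{k-1}-1$ variables is called complete (equivalently: for every non-constant $v\in\{0,1\}^k$ exactly one of $v$ and its complement $\bar v$ is a column of $M_f$). A DNF is a disjunction of conjunctions of literals ($x_i$ or $\bar x_i$); its rank is the total number of literal occurrences in it, and its length is the number of its conjunctions. A DNF realizes $f$ if it equals $f$ as a Boolean function. *)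

(* Defs.v *)
From mathcomp Require Import all_boot all_order all_algebra.
From mathcomp Require Import reals sequences exp.

Set Implicit Arguments.
Unset Strict Implicit.
Unset Printing Implicit Defensive.

Import Order.TTheory GRing.Theory Num.Theory.

Definition bool_fun (n : nat) := 'rV[bool]_n -> bool.

Definition zeros n (f : bool_fun n) : {set 'rV[bool]_n} := [set x | ~~ f x].

(* Rows are listed in the order of [enum (zeros f)]; the notions below do not
   depend on the order of the rows. *)
Definition zero_matrix n (f : bool_fun n) : 'M[bool]_(#|zeros f|, n) :=
  \matrix_(i < #|zeros f|) (enum_val i : 'rV[bool]_n).

Definition reduced n (f : bool_fun n) : Prop :=
  let M := zero_matrix f in
  [/\ forall i, col i M <> const_mx false,
      forall i, col i M <> const_mx true,
      forall i j, i <> j -> col i M <> col j M &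
      forall i j, i <> j -> col i M <> map_mx negb (col j M)].

Definition complete k n (f : bool_fun n) : Prop :=
  [/\ reduced f, #|zeros f| = k & n = 2 ^ (k - 1) - 1].

(* [(i, true)] is the literal x_i and [(i, false)] its negation. *)
Definition literal (n : nat) : Type := 'I_n * bool.

(* Sequences rather than sets: repeated literals and repeated conjunctions are
   counted in the rank.  The empty conjunction is true, the empty DNF false. *)
Definition conjunction (n : nat) := seq (literal n).
Definition dnf (n : nat) := seq (conjunction n).

Definition eval_literal n (l : literal n) (x : 'rV[bool]_n) : bool :=
  if l.2 then x ord0 l.1 else ~~ x ord0 l.1.
Definition eval_conjunction n (c : conjunction n) (x : 'rV[bool]_n) : bool :=
  all (fun l => eval_literal l x) c.
Definition eval_dnf n (D : dnf n) : bool_fun n :=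
  fun x => has (fun c => eval_conjunction c x) D.

Definition dnf_rank n (D : dnf n) : nat := \sum_(c <- D) size c.

Definition realizes n (D : dnf n) (f : bool_fun n) : Prop := eval_dnf D =1 f.

Definition minimal_dnf n (f : bool_fun n) (D : dnf n) : Prop :=
  realizes D f /\ forall D' : dnf n, realizes D' f -> dnf_rank D <= dnf_rank D'.

Definition log2 (R : realType) (x : R) : R := (ln x / ln 2)%R.

(* Main.v *)
Require Import Defs.
From mathcomp Require Import all_boot all_order all_algebra zify ring lra.
From mathcomp Require Import reals sequences exp.

(* Each literal l is identified with the set Z_l of zeros of f at which it holds;
   by completeness these are exactly the proper nonempty subsets of the k-set of
   zeros, each obtained once.  Flipping the variable of l at a zero outside Z_l
   gives a one of f, and a conjunction covering it contains l while all its other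
   literals hold at that zero.  So every literal occurs, and if l occurs only once,
   in a conjunction c, then every other literal of c holds on the complement of
   Z_l, and c has at least three literals.  Call l light if 3 |Z_l| < 2 k.  If two
   light literals of c occur only once, the complements of their zero sets are
   disjoint of size > k/3, so no further literal of c is light.  Giving weight 3/2
   to literals occurring once and 3/4 to each occurrence of the others, the light
   literals of a conjunction thus weigh at most its length, and the rank is at
   least 3/2 times the number of light literals.  All but an exponentially small
   fraction of the 2 n literals are light. *)

Set Implicit Arguments.
Unset Strict Implicit.
Unset Printing Implicit Defensive.

Import Order.TTheory GRing.Theory Num.Theory.

(** * Literals and the zeros at which they hold *)

Definition neg_literal n (l : literal n) : literal n := (l.1, ~~ l.2).

Definition true_zeros n (f : bool_fun n) (l : literal n) : {set 'rV[bool]_n} :=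
  [set z in zeros f | eval_literal l z].

Definition flip n (i : 'I_n) (z : 'rV[bool]_n) : 'rV[bool]_n :=
  \row_j (if j == i then ~~ z ord0 j else z ord0 j).

(** Counts conjunctions: a literal repeated inside one counts once. *)
Definition occurrences n (D : dnf n) (l : literal n) : nat :=
  count (fun c : conjunction n => l \in c) D.

Definition light n (f : bool_fun n) (l : literal n) : bool :=
  3 * #|true_zeros f l| < 2 * #|zeros f|.

Lemma eval_neg_literal n (l : literal n) z :
  eval_literal (neg_literal l) z = ~~ eval_literal l z.
Proof. by rewrite /eval_literal; case: l => i [] /=; rewrite ?negbK. Qed.

Lemma eval_literal_flip n (l : literal n) i z :
  eval_literal l (flip i z) = eval_literal l z (+) (l.1 == i).
Proof.
rewrite /eval_literal !mxE; case: l => j [] /=; case: (j == i) => /=;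
  by rewrite ?addbT ?addbF.
Qed.

Lemma literal_cases n (l l' : literal n) :
  l.1 = l'.1 -> l' = l \/ l' = neg_literal l.
Proof. by case: l l' => i [] [j []] /= ->; [left|right|right|left]. Qed.

Lemma true_zeros_neg n (f : bool_fun n) l :
  true_zeros f (neg_literal l) = zeros f :\: true_zeros f l.
Proof.
apply/setP=> z; rewrite !inE eval_neg_literal.
by case: (f z); case: (eval_literal l z).
Qed.

Lemma true_zeros_sub n (f : bool_fun n) l : true_zeros f l \subset zeros f.
Proof. by apply/subsetP=> z; rewrite inE => /andP[]. Qed.

(** * Literals as proper nonempty sets of zeros *)

Section Reduced.
Variables (n : nat) (f : bool_fun n).
Hypothesis redf : reduced f.

Lemma column_eq i (P : 'I_#|zeros f| -> bool) :
  (forall r, (enum_val r : 'rV[bool]_n) ord0 i = P r) -> col i (zero_matrix f) = (\col_r P r)%R.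
Proof. by move=> H; apply/matrixP=> r c; rewrite !mxE -H; congr (_ _ _). Qed.

Lemma true_zeros_neq0 l : true_zeros f l != set0.
Proof.
apply/eqP=> E; case: redf => H0 H1 _ _.
have F (r : 'I_#|zeros f|) : eval_literal l (enum_val r) = false.
  move/setP/(_ (enum_val r)): E; rewrite inE in_set0.
  by rewrite enum_valP.
case: l E F => i [] E F.
  apply: (H0 i); rewrite (column_eq (P := fun=> false)) => [|r].
    by apply/matrixP=> r c; rewrite !mxE.
  by have := F r; rewrite /eval_literal.
apply: (H1 i); rewrite (column_eq (P := fun=> true)) => [|r].
  by apply/matrixP=> r c; rewrite !mxE.
by have := F r; rewrite /eval_literal /= => /negbFE.
Qed.

Lemma true_zeros_neqT l : true_zeros f l != zeros f.
Proof.
by have := true_zeros_neq0 (neg_literal l); rewrite true_zeros_neg setD_eq0;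
  apply: contra => /eqP->.
Qed.

(** Over distinct variables, equal sets would make two columns equal or complementary, according to
    the signs; opposite literals of one variable have disjoint nonempty sets. *)
Lemma true_zeros_inj : injective (true_zeros f).
Proof.
move=> l l' E; case: redf => _ _ H2 H3.
have F z : z \in zeros f -> eval_literal l z = eval_literal l' z.
  by move=> zf; move/setP/(_ z): E; rewrite !inE; move: zf; rewrite inE => ->.
have [El|/eqP Nl] := eqVneq l.1 l'.1.
  case: (literal_cases El) => // El'; case/set0Pn: (true_zeros_neq0 l) => z.
  rewrite inE => /andP[zf]; rewrite El' in F.
  by have := F z zf; rewrite eval_neg_literal; case: eval_literal.
have G (r : 'I_#|zeros f|) : eval_literal l (enum_val r) = eval_literal l' (enum_val r).
  exact/F/enum_valP.
have [Eb|Nb] := eqVneq l.2 l'.2.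
  case: (H2 _ _ Nl); rewrite (column_eq (P := fun r => (enum_val r : 'rV[bool]_n) ord0 l'.1)).
    by apply/matrixP=> r c; rewrite !mxE.
  move=> r; have := G r; rewrite /eval_literal Eb.
  by case: l'.2 => // /negb_inj.
case: (H3 _ _ Nl); rewrite (column_eq (P := fun r => ~~ (enum_val r : 'rV[bool]_n) ord0 l'.1)).
  by apply/matrixP=> r c; rewrite !mxE.
move=> r; have := G r; rewrite /eval_literal; move: Nb.
by case: l.2; case: l'.2 => // _ ; case: (_ ord0 l.1); case: (_ ord0 l'.1).
Qed.

(** By counting: the [2 * n] literals inject into the proper nonempty subsets, whose number is
    [2 ^ #|zeros f| - 2], also [2 * n]. *)
Lemma true_zeros_surj (A : {set 'rV[bool]_n}) :
  n = 2 ^ (#|zeros f| - 1) - 1 ->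
  A \subset zeros f -> A != set0 -> A != zeros f ->
  exists l, true_zeros f l = A.
Proof.
move=> hn sA A0 AT.
have k0 : 0 < #|zeros f|.
  by apply: leq_trans (subset_leq_card sA); rewrite card_gt0.
pose S := (powerset (zeros f) :\ set0) :\ zeros f.
have cS : #|[set true_zeros f l | l : literal n]| = #|S|.
  rewrite card_imset; last exact: true_zeros_inj.
  have E2 : 2 ^ #|zeros f| = 2 * 2 ^ (#|zeros f| - 1).
    by rewrite -expnS subn1 prednK.
  have := cardsD1 set0 (powerset (zeros f)).
  have := cardsD1 (zeros f) (powerset (zeros f) :\ set0).
  rewrite !inE sub0set subxx card_powerset -/S -card_gt0 k0 /=.
  rewrite card_prod card_ord card_bool => C1 C2.
  move: hn C1 C2 E2; set p := 2 ^ (_ - 1); set q := 2 ^ _; set s1 := #|_|.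
  by set s2 := #|_|; clearbody p q s1 s2; clear; lia.
have sS : [set true_zeros f l | l : literal n] \subset S.
  apply/subsetP=> _ /imsetP[l _ ->].
  by rewrite !inE true_zeros_neqT true_zeros_neq0 true_zeros_sub.
have: A \in S by rewrite !inE A0 AT.
by rewrite -(subset_cardP cS sS) => /imsetP[l _ ->]; exists l.
Qed.

(** * Conjunctions of a DNF realizing a complete function *)

Hypotheses (hn : n = 2 ^ (#|zeros f| - 1) - 1) (hk : 3 <= #|zeros f|).

(** If the neighbour [z'] were a zero, any literal separating [z] from [z'] would be over variable
    [i]. A third zero [t] gives two separating sets, [{z}] and [{z, t}], that are neither equal nor
    complementary, too many for one variable. *)
Lemma flip_zero i z : z \in zeros f -> f (flip i z).
Proof.
move=> zf; apply/negPn/negP=> nfx; set z' := flip i z in nfx.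
have z'f : z' \in zeros f by rewrite inE.
have zz' : z != z'.
  apply/eqP=> /matrixP/(_ ord0 i); rewrite !mxE eqxx.
  by case: (z ord0 i).
have [t tf] : exists2 t, t \in zeros f & (t != z) && (t != z').
  have: zeros f :\: [set z; z'] != set0.
    rewrite setD_eq0; apply/negP=> /subset_leq_card.
    by rewrite cards2 zz' leqNgt hk.
  case/set0Pn=> t; rewrite !inE negb_or => /andP[? ?]; exists t => //.
  by rewrite inE.
case/andP=> tz tz'.
have sep (A : {set 'rV[bool]_n}) : A \subset zeros f -> z \in A -> z' \notin A ->
    exists2 l, true_zeros f l = A & l.1 = i.
  move=> sA zA z'A; have [||l El] := true_zeros_surj hn sA.
  - by apply/set0Pn; exists z.
  - by apply: contraNneq z'A => ->.
  exists l => //; apply/eqP.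
  move: z'A; rewrite -El inE z'f /= eval_literal_flip.
  by move: zA; rewrite -El inE zf /= => ->; case: eqP.
have [||| l1 E1 i1] := sep [set z].
- by rewrite sub1set.
- by rewrite inE.
- by rewrite inE eq_sym.
have [||| l2 E2 i2] := sep [set z; t].
- by rewrite subUset !sub1set zf.
- by rewrite !inE eqxx.
- by rewrite !inE negb_or eq_sym zz' eq_sym.
have [] : l2 = l1 \/ l2 = neg_literal l1 by apply: literal_cases; rewrite i1.
  move=> El; have: t \in [set z] by rewrite -E1 -El E2 !inE eqxx orbT.
  by rewrite inE (negPf tz).
move=> El; have: z \in true_zeros f l2 by rewrite E2 !inE eqxx.
by rewrite El true_zeros_neg E1 !inE eqxx.
Qed.

Variable D : dnf n.
Hypothesis realD : realizes D f.

Lemma clause_false_on_zeros c z :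
  c \in D -> z \in zeros f -> ~~ eval_conjunction c z.
Proof.
move=> cD; rewrite inE -(realD z); apply: contra => cz.
by apply/hasP; exists c.
Qed.

(* A conjunction covering the neighbour of a zero obtained by flipping the
   variable of [l] must use [l], and all its other literals hold at the zero. *)
Lemma critical_clause l z : z \in zeros f -> z \notin true_zeros f l ->
  exists c, [/\ c \in D, l \in c, neg_literal l \notin c &
    forall l', l' \in c -> l' != l -> z \in true_zeros f l'].
Proof.
move=> zf zl; have := flip_zero l.1 zf; rewrite -(realD (flip l.1 z)).
case/hasP=> c cD cx; exists c; have nlz : eval_literal l z = false.
  by move: zl; rewrite inE zf /= => /negbTE.
have H l' : l' \in c -> l' != l -> z \in true_zeros f l'.
  move=> l'c l'l; rewrite inE zf /=; move/allP/(_ _ l'c): cx.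
  rewrite /= eval_literal_flip; case: eqP => [E|_]; last by rewrite addbF.
  have [El|->] : l' = l \/ l' = neg_literal l by exact: literal_cases.
    by rewrite El eqxx in l'l.
  by rewrite eval_neg_literal nlz.
split=> //; last first.
  apply/negP=> /(allP cx) /=.
  by rewrite eval_literal_flip eval_neg_literal nlz eqxx.
(* Without [l], the conjunction would hold at the zero [z] itself. *)
apply: contraT => lc; have /negP[] := clause_false_on_zeros cD zf.
apply/allP=> l' l'c; have := H l' l'c; rewrite inE zf /=; apply.
by apply: contraNneq lc => <-.
Qed.

Lemma occurrences_gt0 l : 0 < occurrences D l.
Proof.
have: ~~ (zeros f \subset true_zeros f l).
  apply/negP=> sl; case/negP: (true_zeros_neqT l).
  by rewrite eqEsubset sl true_zeros_sub.
case/subsetPn=> z zf zl; have [c [cD lc _ _]] := critical_clause zf zl.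
by rewrite -has_count; apply/hasP; exists c.
Qed.

Lemma occurrences1_clause l c c' : occurrences D l = 1 ->
  c \in D -> l \in c -> c' \in D -> l \in c' -> c = c'.
Proof.
rewrite /occurrences -size_filter => E cD lc c'D lc'.
have: c' \in [seq c <- D | l \in c] by rewrite mem_filter lc'.
have: c \in [seq c <- D | l \in c] by rewrite mem_filter lc.
by case: filter E => [|a []] //= _; rewrite !inE => /eqP-> /eqP->.
Qed.

Lemma single_occurrence_clause l c : occurrences D l = 1 -> c \in D -> l \in c ->
  forall l', l' \in c -> l' != l ->
  zeros f :\: true_zeros f l \subset true_zeros f l'.
Proof.
move=> occ cD lc l' l'c l'l; apply/subsetP=> z /setDP[zf zl].
have [c' [c'D lc' _ H]] := critical_clause zf zl.
by apply: H l'l; rewrite -(occurrences1_clause occ cD lc c'D lc').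
Qed.

(** A zero in the set of [l] makes some other literal [l1] of [c] false. As [l1] is not the negation
    of [l], their sets meet, and a common zero requires a third literal, false there. *)
Lemma single_occurrence_size l c : occurrences D l = 1 -> c \in D -> l \in c ->
  3 <= #|[set l' in c]|.
Proof.
move=> occ cD lc; have H := single_occurrence_clause occ cD lc.
have [z1] := set0Pn _ (true_zeros_neq0 l); rewrite inE => /andP[z1f lz1].
have [l1 l1c nl1] := allPn (clause_false_on_zeros cD z1f).
have l1l : l1 != l by apply: contraNneq nl1 => ->.
have [z2] : exists z, z \in true_zeros f l :&: true_zeros f l1.
  apply/set0Pn; apply/negP=> /eqP I0.
  have El1 : l1 = neg_literal l.
    apply: true_zeros_inj; rewrite true_zeros_neg; apply/eqP.
    rewrite eqEsubset (H _ l1c l1l) subsetD true_zeros_sub /=.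
    by rewrite -setI_eq0 setIC I0 eqxx.
  have [z0] := set0Pn _ (true_zeros_neq0 (neg_literal l)).
  rewrite true_zeros_neg => /setDP[z0f z0l].
  have [c' [c'D lc' nlc' _]] := critical_clause z0f z0l.
  have Ec := occurrences1_clause occ cD lc c'D lc'.
  by case/negP: nlc'; rewrite -Ec -El1.
rewrite inE => /andP[lz2 l1z2].
have z2f := subsetP (true_zeros_sub f l) _ lz2.
have [l2 l2c nl2] := allPn (clause_false_on_zeros cD z2f).
have l2P l' : z2 \in true_zeros f l' -> l2 != l'.
  by rewrite inE => /andP[_ l'z2]; apply: contraNneq nl2 => ->.
apply/card_gt2P; exists l, l1, l2; rewrite !inE; split=> //; split.
- by rewrite eq_sym.
- by rewrite eq_sym l2P.
- exact: l2P.
Qed.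

(** A third literal of [c] would hold on both disjoint complements, hence on more than two thirds of
    the zeros. *)
Lemma light_single_occurrences c l1 l2 :
  occurrences D l1 = 1 -> occurrences D l2 = 1 -> light f l1 -> light f l2 ->
  c \in D -> l1 \in c -> l2 \in c -> l1 != l2 ->
  forall l, l \in c -> light f l -> (l == l1) || (l == l2).
Proof.
move=> o1 o2; rewrite /light => L1 L2 cD l1c l2c l12 l lc L.
apply: contraLR L; rewrite negb_or => /andP[ll1 ll2].
have s1 := single_occurrence_clause o1 cD l1c lc ll1.
have s2 := single_occurrence_clause o2 cD l2c lc ll2.
have s12 : zeros f :\: true_zeros f l1 \subset true_zeros f l2.
  by apply: (single_occurrence_clause o1 cD l1c l2c); rewrite eq_sym.
have dis : (zeros f :\: true_zeros f l1) :&: (zeros f :\: true_zeros f l2) = set0.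
  apply/setP=> z; rewrite in_set0; apply/negbTE/negP=> /setIP[/(subsetP s12) z2].
  by case/setDP=> _; rewrite z2.
have := subset_leq_card (_ : (zeros f :\: true_zeros f l1) :|:
  (zeros f :\: true_zeros f l2) \subset true_zeros f l).
rewrite subUset s1 s2 cardsU dis cards0 !cardsDS ?true_zeros_sub // => /(_ isT).
move: L1 L2; set a := #|_|; set b := #|_|; lia.
Qed.

(** * Weighted counting of light literals *)

(* Four times the weights 3/2 and 3/4. *)
Definition weight l := if occurrences D l == 1 then 6 else 3.

(** With [M] the light literals of [c] and [U] those occurring once, the sum is
    [3 * #|M| + 3 * #|U|]. If [U] has two elements, [M = U] and the sum is 12; if it has one, the
    sum is at most [3 * size c + 3]. In both cases [size c] is at least 3. *)
Lemma clause_weight c : c \in D ->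
  \sum_(l | (l \in c) && light f l) weight l <= 4 * size c.
Proof.
move=> cD; pose S := [set l in c].
pose M := [set l in c | light f l].
have sMS : M \subset S by apply/subsetP=> l; rewrite !inE => /andP[].
have cS : #|S| <= size c by rewrite cardsE card_size.
have cM := subset_leq_card sMS.
pose U := [set l in M | occurrences D l == 1].
have EW : \sum_(l | (l \in c) && light f l) weight l = 3 * #|M| + 3 * #|U|.
  rewrite (eq_bigl (mem M)) => [|l]; last by rewrite !inE.
  rewrite (eq_bigr (fun l => 3 + (if occurrences D l == 1 then 3 else 0))).
    rewrite big_split /= sum_nat_const mulnC; congr addn.
    rewrite -big_mkcondr /= (eq_bigl (mem U)) => [|l]; last by rewrite !inE.
    by rewrite sum_nat_const mulnC.
  by move=> l _; rewrite /weight; case: ifP.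
rewrite EW; have UP l : l \in U -> [/\ l \in c, light f l & occurrences D l = 1].
  by rewrite !inE => /andP[/andP[? ?] /eqP].
have [/card_gt1P[l1 [l2 [l1U l2U l12]]]|U1] := ltnP 1 #|U|.
  have [l1c L1 o1] := UP _ l1U; have [l2c L2 o2] := UP _ l2U.
  have sM : M \subset [set l1; l2].
    apply/subsetP=> l; rewrite !inE => /andP[lc L].
    exact: (light_single_occurrences o1 o2 L1 L2 cD l1c l2c l12 lc L).
  have := subset_leq_card sM; rewrite cards2 l12.
  have : #|U| <= #|M|.
    by apply/subset_leq_card/subsetP=> l; rewrite inE => /andP[].
  have := single_occurrence_size o1 cD l1c; rewrite -/S; lia.
have [U0|/card_gt0P[l lU]] := posnP #|U|; first by lia.
have [lc _ o] := UP _ lU.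
have := single_occurrence_size o cD lc; rewrite -/S; lia.
Qed.

(** Double counting: each light literal receives total weight at least 6, either 6 once or 3 at
    least twice. *)
Lemma light_rank : 3 * #|[set l | light f l]| <= 2 * dnf_rank D.
Proof.
have : \sum_(c <- D) \sum_(l | (l \in c) && light f l) weight l <= 4 * dnf_rank D.
  rewrite /dnf_rank big_distrr /= big_seq [leqRHS]big_seq.
  by apply: leq_sum => c; exact: clause_weight.
suff : 6 * #|[set l | light f l]| <=
       \sum_(c <- D) \sum_(l | (l \in c) && light f l) weight l by lia.
rewrite (exchange_big_dep (fun l => light f l)) /=; last by move=> c l _ /andP[].
rewrite mulnC -sum_nat_const.
rewrite [leqLHS](eq_bigl (fun l => light f l)) => [|l]; last by rewrite inE.
apply: leq_sum => l L; rewrite (eq_bigl (fun c => l \in c)) => [|c]; last first.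
  by rewrite L andbT.
rewrite big_const_seq iter_addn_0 -/(occurrences D l) /weight.
have := occurrences_gt0 l; case: eqP => [->//|]; lia.
Qed.

End Reduced.

(** * Counting the literals that are not light *)

(* Exponential moment bound with parameter 2, as [3 ^ k] is the sum of
   [2 ^ #|A|] over the subsets [A] of [Z]; it is cubed to keep [2 ^ (2 k / 3)]
   an integer. *)
Lemma card_large_subsets (T : finType) (Z : {set T}) :
  #|[set A : {set T} | (A \subset Z) && (2 * #|Z| <= 3 * #|A|)]| ^ 3 * 4 ^ #|Z|
    <= 27 ^ #|Z|.
Proof.
(* [t] is [2 * k / 3] rounded up. *)
set F := [set A | _]; set k := #|Z|; pose t := (2 * k + 2) %/ 3.
have Ft : #|F| * 2 ^ t <= 3 ^ k.
  (* Expanding this product gives a sum over all subsets of [T], in which those not inside [Z]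
     contribute 0. *)
  have -> : 3 ^ k = \prod_(i : T) ((if i \in Z then 2 else 0) + 1).
    rewrite (bigID (mem Z)) /= [X in _ * X]big1 ?muln1 => [|i /negbTE->//].
    rewrite (eq_bigr (fun=> 3)) ?prod_nat_const // => i /= iZ.
    by rewrite iZ.
  rewrite bigA_distr /= -sum_nat_const big_mkcond /=; apply: leq_sum => A _.
  case: ifP => //; rewrite inE => /andP[sA hA].
  rewrite (bigID (mem A)) /= [X in _ * X]big1 ?muln1 => [|i /negbTE->//].
  rewrite (eq_bigr (fun=> 2)) => [|i iA]; last by rewrite iA (subsetP sA).
  by rewrite prod_nat_const leq_exp2l //; move: hA; rewrite /t -/k; lia.
have t3 : 4 ^ k <= (2 ^ t) ^ 3.
  by rewrite -expnM -[4]/(2 ^ 2) -expnM leq_exp2l // /t; lia.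
apply: leq_trans (leq_mul (leqnn _) t3) _.
by rewrite -expnMn -[27]/(3 ^ 3) -!expnM [3 * k]mulnC expnM leq_exp2r.
Qed.

(** The successor accounts for [zeros f] itself: a large subset that belongs to no literal. *)
Lemma card_heavy_literals n (f : bool_fun n) : reduced f ->
  #|[set l | ~~ light f l]|.+1 ^ 3 * 4 ^ #|zeros f| <= 27 ^ #|zeros f|.
Proof.
move=> redf; apply: leq_trans (card_large_subsets (zeros f)).
rewrite leq_mul2r leq_exp2r // orbC.
rewrite -(card_imset _ (true_zeros_inj redf)).
set I := imset _ _; have <- : #|zeros f |: I| = #|I|.+1.
  rewrite cardsU1; case: imsetP => //= -[l _ E].
  by case/eqP: (true_zeros_neqT redf l).
apply/orP; left; apply/subset_leq_card/subsetP=> A; rewrite !inE.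
case/orP=> [/eqP->|/imsetP[l + ->]]; first by rewrite subxx /=; lia.
by rewrite inE /light -leqNgt true_zeros_sub.
Qed.

Lemma card_light_literals n (f : bool_fun n) :
  #|[set l | light f l]| + #|[set l | ~~ light f l]| = 2 * n.
Proof.
have -> : [set l | ~~ light f l] = ~: [set l | light f l].
  by apply/setP=> l; rewrite !inE.
by rewrite cardsC card_prod card_ord card_bool mulnC.
Qed.

(** * Real estimates *)

Local Open Scope ring_scope.

(** Each induction step multiplies the left side by 27 and the right side by at least
    [8 * (11 / 12) * 4 = 88 / 3]. The inequality fails at [k = 3]. *)
Lemma cube_large_subsets_bound (R : realType) k : (4 <= k)%N ->
  27 ^+ k <= (2 ^+ k - 2) ^+ 3 * (11 / 12) ^+ k.-1 * 4 ^+ k :> R.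
Proof.
elim: k => [//|k IH]; rewrite leq_eqVlt => /orP[/eqP<-/=|]; first by lra.
rewrite ltnS => k4; have {}IH := IH k4.
have -> : (k.+1.-1 = k.-1.+1)%N by lia.
have x4 : (4 : R) <= 2 ^+ k.
  by rewrite (_ : 4 = 2 ^+ 2) ?ler_eXn2l ?ltr1n //; [lia|lra].
rewrite [27 ^+ _]exprS [2 ^+ _]exprS [(11 / 12) ^+ _]exprS [4 ^+ _]exprS.
set x := 2 ^+ k in IH x4 *.
set u := (11 / 12) ^+ k.-1 in IH *; set v := 4 ^+ k in IH *.
have u0 : 0 <= u by rewrite exprn_ge0 //; lra.
have v0 : 0 <= v by rewrite exprn_ge0.
have uv0 : 0 <= u * v by rewrite mulr_ge0.
apply: (@le_trans _ _ (27 * ((x - 2) ^+ 3 * u * v))); first by rewrite ler_pM2l.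
have h3 : 8 * (x - 2) ^+ 3 <= (2 * x - 2) ^+ 3.
  have -> : 8 * (x - 2) ^+ 3 = (2 * (x - 2)) ^+ 3 by ring.
  by rewrite lerXn2r ?nnegrE; lra.
have p3 : 0 <= (x - 2) ^+ 3 by rewrite exprn_ge0 //; lra.
have := ler_wpM2r uv0 h3; have := mulr_ge0 p3 uv0.
have -> : (2 * x - 2) ^+ 3 * (11 / 12 * u) * (4 * v) =
          11 / 3 * ((2 * x - 2) ^+ 3 * (u * v)) by field.
have -> : 27 * ((x - 2) ^+ 3 * u * v) = 27 * ((x - 2) ^+ 3 * (u * v)) by ring.
have -> : 8 * (x - 2) ^+ 3 * (u * v) = 8 * ((x - 2) ^+ 3 * (u * v)) by ring.
lra.
Qed.

Lemma heavy_bound (R : realType) (k b : nat) : (3 <= k)%N ->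
  (b.+1 ^ 3 * 4 ^ k <= 27 ^ k)%N ->
  b%:R <= (2 ^+ k - 2) * expR (- ((k.-1)%:R / 36)) :> R.
Proof.
rewrite leq_eqVlt => /orP[/eqP<- hb|k4 hb].
  (* For [k = 3] the successor in the hypothesis is essential: [b = 6] would violate the conclusion,
     whereas [6 * (1 - 1 / 18)] exceeds 5. *)
  have b5 : (b <= 5)%N.
    rewrite leqNgt; apply/negP=> b6; move: hb; apply/negP; rewrite -ltnNge.
    apply: (@leq_trans (7 ^ 3 * 4 ^ 3)) => //.
    by rewrite leq_mul2r leq_exp2r // ltnS b6 orbT.
  have := expR_ge1Dx (- (2%:R / 36) : R).
  have : b%:R <= 5 :> R by rewrite ler_nat.
  by rewrite /=; lra.
set y := expR (- 36^-1) : R.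
have -> : expR (- ((k.-1)%:R / 36)) = y ^+ k.-1 :> R.
  by rewrite -expRM_natl mulrN.
have y0 : 0 <= y by exact: expR_ge0.
(* Cubing turns the rate [1 / 36] into [1 / 12], whence the constant [11 / 12 = 1 - 1 / 12]. *)
have y3 : 11 / 12 <= y ^+ 3.
  rewrite -expRM_natl; have := expR_ge1Dx (3%:R * - 36^-1 : R).
  by apply: le_trans; lra.
have x2 : 0 <= 2 ^+ k - 2 :> R.
  by rewrite subr_ge0 -{1}[2]expr1 ler_eXn2l ?ltr1n //; lia.
have b0 : b%:R <= b.+1%:R :> R by rewrite ler_nat.
apply: le_trans b0 _.
rewrite -(@ler_pXn2r _ 3) ?nnegrE ?ler0n ?mulr_ge0 ?exprn_ge0 //.
rewrite -(@ler_pM2r _ (4 ^+ k)) ?exprn_gt0 //.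
apply: (@le_trans _ _ (27 ^+ k)); first by rewrite -!natrX -natrM ler_nat.
apply: le_trans (cube_large_subsets_bound R k4) _.
rewrite ler_pM2r ?exprn_gt0 // [leRHS]exprMn; apply: ler_wpM2l; first exact: exprn_ge0.
by rewrite -exprM mulnC exprM lerXn2r ?nnegrE ?exprn_ge0 //; lra.
Qed.

Lemma log2_le (R : realType) (n k : nat) : (0 < n <= 2 ^ k)%N ->
  log2 (n%:R : R) <= k%:R.
Proof.
case/andP=> n0 nk; have l2 : 0 < ln 2 :> R by rewrite ln_gt0 ?ltr1n.
rewrite /log2 ler_pdivrMr // mulr_natl -lnXn //.
by rewrite ler_ln ?posrE ?ltr0n ?exprn_gt0 // -natrX ler_nat.
Qed.

Local Close Scope ring_scope.

(** * The lower bound on the rank *)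

Theorem theorem3 (R : realType) (k n : nat) (f : bool_fun n) (D : dnf n)
    (hk : 2 <= k) (hn : n = 2 ^ (k - 1) - 1)
    (hf : complete k f) (hD : minimal_dnf f D) :
  (3 * n%:R * (1 - expR (- (log2 (n%:R : R) / 36))) <= (dnf_rank D)%:R :> R)%R.
Proof.
case: hf hD => redf cZ _ [realD _].
move: hk; rewrite leq_eqVlt => /orP[/eqP k2|k3].
  (* For [k = 2] there is no third zero, but [n = 1] makes the bound 0. *)
  have -> : (n%:R = 1 :> R)%R by rewrite hn -k2.
  by rewrite /log2 ln1 !mul0r oppr0 expR0 subrr mulr0.
have hnZ : n = 2 ^ (#|zeros f| - 1) - 1 by rewrite cZ.
have k3Z : 3 <= #|zeros f| by rewrite cZ.
have rk := light_rank redf hnZ k3Z realD.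
have := card_heavy_literals redf; rewrite cZ => /(heavy_bound R k3).
have := card_light_literals f.
set a := #|_| in rk *; set b := #|_| => ab hb.
have p2 : 2 ^ 2 <= 2 ^ (k - 1) by rewrite leq_exp2l //; lia.
have n2 : (2 ^+ k - 2 = (2 * n)%N%:R :> R)%R.
  have E : 2 ^ k = 2 * n + 2.
    rewrite -[in LHS](@ltn_predK 0 k) ?expnS -?subn1; lia.
  by rewrite -natrX E natrD addrK.
(* Since [n < 2 ^ (k - 1)], the exponent [k - 1] dominates [log2 n]. *)
have le_exp : (expR (- ((k.-1)%:R / 36)) <= expR (- (log2 (n%:R : R) / 36)))%R.
  rewrite ler_expR lerN2 ler_pM2r ?invr_gt0 //; apply: log2_le.
  by rewrite -subn1; lia.
have n0 : (0 <= (2 * n)%N%:R :> R)%R by [].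
rewrite n2 in hb; have {hb} := le_trans hb (ler_wpM2l n0 le_exp).
set e := expR _ => hb.
have {}ab : (a%:R + b%:R = 2 * n%:R :> R)%R by rewrite -natrD ab natrM.
have {}rk : (3 * a%:R <= 2 * (dnf_rank D)%:R :> R)%R by rewrite -!natrM ler_nat.
rewrite natrM in hb.
(* The rank is at least [3 / 2 * a = 3 / 2 * (2 * n - b)], and [b] is at most [2 * n * e]. *)
have -> : (3 * n%:R * (1 - e) = 3 * n%:R - 3 / 2 * (2 * n%:R * e) :> R)%R by field.
lra.
Qed.
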